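(* Let $n\ge 2$ be an integer and let $x,y$ be complex numbers such that no denominator below vanishes, i.e. $x\notin\{-1,\dots,-n\}$, $x-y\notin\{-1,\dots,-n\}$ and $y\notin\{-n,-n+1,\dots,n-1\}$. Then $$\sum_{k=0}^n(-1)^k\binom{n}{k}\frac{\binom{y+k}{k}}{\binom{y-n+k}{k}}\frac{(y-1)y}{(y+k-1)(y+k)}H_{k}^{\langle4\rangle}(x)$$ $$=\frac{(-1)^n}{6n(n-1)(1+x-y)}\,\frac{\binom{x-y+n}{n}}{\binom{x+n}{n}\binom{y}{n}}\bigg\{(1+x-y+ny)E_n(x,y)+\frac{3ny}{1+x-y}F_n(x,y)+G_n(x,y)\bigg\},$$ where $$E_n(x,y)=\big[H_{n}(x)-H_{n}(x-y)\big]^3+2\big[H_{n}^{\langle3\rangle}(x)-H_{n}^{\langle3\rangle}(x-y)\big]+3\big[H_{n}(x)-H_{n}(x-y)\big]\big[H_{n}^{\langle2\rangle}(x)-H_{n}^{\langle2\rangle}(x-y)\big],$$ $$F_n(x,y)=\big[H_{n}(x)-H_{n}(x-y)\big]^2+\big[H_{n}^{\langle2\rangle}(x)-H_{n}^{\langle2\rangle}(x-y)\big],$$ $$G_n(x,y)=\frac{6ny}{(1+x-y)^2}\big[H_{n}(x)-H_{n}(x-y)\big]+\frac{6ny}{(1+x-y)^3}.$$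
   Context: For a complex number $u$ and an integer $k\ge 0$, $\binom{u}{k}=\frac{u(u-1)\cdots(u-k+1)}{k!}$ (equal to $1$ for $k=0$). For a complex number $u$ and a positive integer $\ell$, the generalized harmonic numbers of $\ell$-order are $H_0^{\langle\ell\rangle}(u)=0$ and $H_n^{\langle\ell\rangle}(u)=\sum_{k=1}^n\frac{1}{(u+k)^\ell}$ for $n\ge1$; $H_n(u)=H_n^{\langle1\rangle}(u)$. *)

(* Defs.v *)
From mathcomp Require Import all_boot all_order all_algebra.
From mathcomp Require Export reals complex.

Set Implicit Arguments.
Unset Strict Implicit.
Unset Printing Implicit Defensive.

Import GRing.Theory Num.Theory.
Local Open Scope ring_scope.

Section Defs.
Variable F : numFieldType.
Implicit Types (u x y : F) (n k l : nat).

Definition gbin u k : F := (\prod_(i < k) (u - i%:R)) / (k`!)%:R.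

(* gharm l n u is H_n^{<l>}(u); the sum is empty for n = 0. *)
Definition gharm l n u : F := \sum_(1 <= k < n.+1) 1 / (u + k%:R) ^+ l.

Definition dharm l n x y : F := gharm l n x - gharm l n (x - y).

Definition En n x y : F :=
  dharm 1 n x y ^+ 3 + 2 * dharm 3 n x y + 3 * dharm 1 n x y * dharm 2 n x y.

Definition Fn n x y : F := dharm 1 n x y ^+ 2 + dharm 2 n x y.

Definition Gn n x y : F :=
  6 * n%:R * y / (1 + x - y) ^+ 2 * dharm 1 n x y
  + 6 * n%:R * y / (1 + x - y) ^+ 3.

End Defs.

(* Main.v *)
Require Import Defs.
From mathcomp Require Import all_boot all_order all_algebra.
From mathcomp Require Import reals complex.
From mathcomp Require Import ring zify.
Import GRing.Theory Num.Theory.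
Local Open Scope ring_scope.
Local Open Scope complex_scope.

(** With [n = m + 1], the summand without its harmonic factor has, by Gosper's
    algorithm, closed-form partial sums [S_k], and [S_n = 0].  Summation by
    parts turns the left-hand side into [- sum_(j <= m) S_j / (x + j + 1)^4],
    which is the third Taylor coefficient in [t] of
    [sum_(j <= m) S_j / (x + t + j + 1)].  Up to a constant factor this is,
    without its polynomial part [1], the partial fraction decomposition of
    [(1 + n y / (1 + x + t - y)) prod_(j <= m) (x + t - y + j + 1) / (x + t + j + 1)],
    and the product expands as the exponential of a combination of power sums,
    i.e. of differences of generalized harmonic numbers.  Jets are polynomials
    in [t] compared modulo [t^4]. *)

(** * Taylor jets modulo [t^4] *)

Definition jet {F : numFieldType} (a b c d : F) : {poly F} :=
  a%:P + b%:P * 'X + c%:P * 'X^2 + d%:P * 'X^3.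

Lemma coef_jet (F : numFieldType) (a b c d : F) i :
  (jet a b c d)`_i = nth 0 [:: a; b; c; d] i.
Proof.
rewrite /jet !coefD !coefCM coefC coefX !coefXn.
by case: i => [|[|[|[|i]]]] /=; rewrite ?mulr0 ?mulr1 ?addr0 ?add0r ?nth_nil.
Qed.

(** Truncated geometric series of [1 / (t + u)]. Its last coefficient is the source of the fourth
    powers in the sum. *)
Definition inv_jet {F : numFieldType} (u : F) : {poly F} :=
  jet (u^-1) (- u^-1 ^+ 2) (u^-1 ^+ 3) (- u^-1 ^+ 4).

Lemma inv_jetP (F : numFieldType) (u : F) : u != 0 ->
  ('X + u%:P) * inv_jet u = 1 - (u^-1 ^+ 4)%:P * 'X^4.
Proof.
move=> u0; have e : u%:P * (u^-1)%:P = 1 :> {poly F}.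
  by rewrite -polyCM divff.
rewrite /inv_jet /jet; move: e; rewrite !(rmorphN, rmorphXn) /=.
by move: (u%:P) (u^-1%:P) => U V e; ring: e.
Qed.

(* The Taylor jet of 6 exp (- s1 t + s2 t^2 / 2 - s3 t^3 / 3), for the power
   sums s1, s2, s3. *)
Definition exp_jet {F : numFieldType} (s1 s2 s3 : F) : {poly F} :=
  jet 6 (- 6 * s1) (3 * (s1 ^+ 2 + s2)) (- (s1 ^+ 3 + 2 * s3 + 3 * s1 * s2)).

Lemma gharmS (F : numFieldType) l n (u : F) :
  gharm l n.+1 u = gharm l n u + (u + n.+1%:R)^-1 ^+ l.
Proof. by rewrite /gharm big_nat_recr //= div1r exprVn. Qed.

(** The logarithm of [prod (1 + t / v_j) / (1 + t / u_j)] is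
    [- s1 t + s2 t^2 / 2 - s3 t^3 / 3 + ...], where [s_k] is the difference of the [k]-th power sums
    of the [1 / u_j] and the [1 / v_j]. Denominators are cleared, and [r] carries the error. *)
Lemma quotient_jet (F : numFieldType) (u v : F) n :
    (forall j : nat, (j < n)%N -> u + j.+1%:R != 0) ->
    (forall j : nat, (j < n)%N -> v + j.+1%:R != 0) ->
  exists r : {poly F},
    6%:P * (\prod_(j < n) (u + j.+1%:R))%:P
      * \prod_(j < n) ('X + (v + j.+1%:R)%:P)
    = (\prod_(j < n) (v + j.+1%:R))%:P
      * exp_jet (gharm 1 n u - gharm 1 n v) (gharm 2 n u - gharm 2 n v)
                  (gharm 3 n u - gharm 3 n v)
      * \prod_(j < n) ('X + (u + j.+1%:R)%:P) + 'X^4 * r.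
Proof.
elim: n => [|n IH] hu hv.
  exists 0; rewrite !big_ord0 /gharm !big_geq // /exp_jet /jet.
  by rewrite !subr0; ring.
have [|| r hr] := IH; [by move=> j h; apply/hu/ltnW | by move=> j h; apply/hv/ltnW | ].
have {hu}u0 := hu n (ltnSn n); have {hv}v0 := hv n (ltnSn n).
rewrite !big_ord_recr /= !gharmS.
move: (gharm 1 n u) (gharm 1 n v) (gharm 2 n u) (gharm 2 n v)
  (gharm 3 n u) (gharm 3 n v) hr => a1 b1 a2 b2 a3 b3.
move: (u + _) (v + _) u0 v0 => U V u0 v0.
move: (\prod_(j < n) _) (\prod_(j < n) _) => N A.
move: (\prod_(j < n) _) (\prod_(j < n) _) => M B hr.
have eU : U%:P * (U^-1)%:P = 1 :> {poly F} by rewrite -polyCM divff.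
have eV : V%:P * (V^-1)%:P = 1 :> {poly F} by rewrite -polyCM divff.
set s1 := a1 + _ - _; set s2 := a2 + _ - _; set s3 := a3 + _ - _.
(* Adding one factor to each product updates the jet by [(1 + t / V) / (1 + t / U)]. Both cleared
   sides have degree at most 4, and [e] is the difference of their [t^4] coefficients. *)
have [e hJ] : exists e : {poly F}, exp_jet s1 s2 s3 * (1 + (U^-1)%:P * 'X) =
    exp_jet (a1 - b1) (a2 - b2) (a3 - b3) * (1 + (V^-1)%:P * 'X) - e * 'X^4.
  exists (U^-1 * (s1 ^+ 3 + 2 * s3 + 3 * s1 * s2)
       - V^-1 * ((a1 - b1) ^+ 3 + 2 * (a3 - b3)
                 + 3 * (a1 - b1) * (a2 - b2)))%:P.
  rewrite /exp_jet /jet /s1 /s2 /s3; move: (U^-1) (V^-1) => a b; ring.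
exists (('X + V%:P) * U%:P * r + B%:P * M * U%:P * V%:P * e).
have XU : 'X + U%:P = U%:P * (1 + (U^-1)%:P * 'X) by ring: eU.
have XV : 'X + V%:P = V%:P * (1 + (V^-1)%:P * 'X) by ring: eV.
rewrite !polyCM.
transitivity (('X + V%:P) * U%:P * (6%:P * A%:P * N)); first by ring.
transitivity (B%:P * V%:P * U%:P * M * (exp_jet s1 s2 s3 * (1 + (U^-1)%:P * 'X))
  + 'X^4 * (('X + V%:P) * U%:P * r + B%:P * M * U%:P * V%:P * e)).
  rewrite hr hJ XV; ring.
by rewrite XU; ring.
Qed.

(** * Partial fractions and cancellation modulo powers of [t] *)

Lemma monic_size_prod_XaddC (F : numFieldType) (u : nat -> F) n :
  \prod_(j < n) ('X + (u j)%:P) \is monic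
  /\ size (\prod_(j < n) ('X + (u j)%:P)) = n.+1.
Proof.
elim: n => [|n [mon sz]]; first by rewrite big_ord0 monic1 size_poly1.
rewrite big_ord_recr /=; split; first by rewrite monicMr ?monicXaddC.
by rewrite size_Mmonic ?monicXaddC ?monic_neq0 // sz size_XaddC addn2.
Qed.

(* Partial fraction decomposition of [prod (X + v_j) / prod (X + u_j)]. *)
Lemma lagrange_prod (F : numFieldType) (u v r : nat -> F) n :
    {in gtn n &, injective u} ->
    (forall j : 'I_n, \prod_(i < n) (v i - u j)
       = r j * \prod_(i < n | i != j) (u i - u j)) ->
  \prod_(i < n) ('X + (v i)%:P) = \prod_(i < n) ('X + (u i)%:P)
    + \sum_(j < n) (r j)%:P * \prod_(i < n | i != j) ('X + (u i)%:P).
Proof.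
move=> inju hr; apply/eqP; rewrite -subr_eq0 opprD addrA; apply/eqP.
have hp (w : nat -> F) (P : pred 'I_n) x :
    (\prod_(i < n | P i) ('X + (w i)%:P)).[x] = \prod_(i < n | P i) (w i + x).
  by rewrite horner_prod; apply: eq_bigr => i _; rewrite !hornerE addrC.
(* The leading terms of the two monic products cancel, so the difference has size at most [n]. It
   vanishes at the [n] distinct points [- u j], where only the [j]-th summand survives. *)
apply: (@roots_geq_poly_eq0 _ _ [seq - u j | j <- iota 0 n]).
- apply/allP => x /mapP [j0]; rewrite mem_iota add0n /= => ltjn ->.
  pose j := Ordinal ltjn; rewrite -[j0]/(nat_of_ord j).
  have u0 : \prod_(i < n) (u i - u j) = 0 by rewrite (bigD1 j) //= subrr mul0r.
  rewrite /root !(hornerD, hornerN) horner_sum !hp hr u0 subr0 subr_eq0.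
  rewrite [\sum_(i < n) _](bigD1 j) //= hornerM hornerC hp.
  rewrite [\sum_(i < n | _) _]big1 ?addr0 // => k nkj.
  rewrite hornerM hp (bigD1 j) /=; last by rewrite eq_sym.
  by rewrite subrr mul0r mulr0.
- rewrite map_inj_in_uniq ?iota_uniq // => i j.
  by rewrite !mem_iota !add0n /= => ltin ltjn /oppr_inj /inju; apply.
rewrite size_map size_iota.
have [[monu szu] [monv szv]] :=
  (monic_size_prod_XaddC F u n, monic_size_prod_XaddC F v n).
have sz (j : 'I_n) : size (\prod_(i < n | i != j) ('X + (u i)%:P)) = n.
  move: szu; rewrite (bigD1 j) //= mulrC size_Mmonic ?monicXaddC //.
    by rewrite size_XaddC addn2 => -[].
  by apply/monic_neq0/monic_prod => i _; apply: monicXaddC.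
apply/leq_sizeP => i leni; rewrite !coefB coef_sum [\sum_(j < n) _]big1 => [|j _]; last first.
  by rewrite coefCM [_`_i]nth_default ?mulr0 // sz.
rewrite subr0; move: leni; rewrite leq_eqVlt => /predU1P [<-|ltni].
  move: monu monv; rewrite !monicE !lead_coefE szu szv /= => /eqP -> /eqP ->.
  by rewrite subrr.
by rewrite !nth_default ?subrr // ?szu ?szv.
Qed.

(** A polynomial with nonzero constant term is coprime to ['X], so cleared denominators can be
    cancelled from a congruence modulo ['X^n]. *)
Lemma coef_mulXn_eq0 (F : numFieldType) (p q : {poly F}) n i :
  q`_0 != 0 -> (i < n)%N -> 'X^n %| p * q -> p`_i = 0.
Proof.
move=> q0 ltin; rewrite Gauss_dvdpl.
  by move=> /dvdpP [r ->]; rewrite coefMXn ltin.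
by apply: coprimep_expl; rewrite coprimep_sym coprimepX /root horner_coef0.
Qed.

(** * Summation by parts and the closed form of the partial sums *)

Lemma sum_gharm (F : numFieldType) (c S : nat -> F) l n (x : F) :
    c 0%N = S 0%N ->
    (forall k, (k < n)%N -> c k.+1 = S k.+1 - S k) ->
  \sum_(0 <= k < n.+1) c k * gharm l k x
    = S n * gharm l n x - \sum_(j < n) S j * (x + j.+1%:R)^-1 ^+ l.
Proof.
move=> c0; elim: n => [|n IH] cS.
  by rewrite big_nat1 big_ord0 subr0 c0.
rewrite big_nat_recr //= IH => [|k ltkn]; last exact/cS/ltnW.
by rewrite cS // gharmS big_ord_recr /=; ring.
Qed.

Lemma gbinE (F : numFieldType) (u : F) n :
  gbin (u + n%:R) n = (\prod_(j < n) (u + j.+1%:R)) / n`!%:R.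
Proof.
rewrite /gbin (reindex_inj rev_ord_inj) /=; congr (_ / _).
by apply: eq_bigr => j _; rewrite natrB //; ring.
Qed.

Definition poch_ratio {F : numFieldType} (y : F) m k : F :=
  \prod_(i < k) ((y + i%:R) / (y - m%:R + i%:R)).

(* Closed form of the sum of the first [k + 1] coefficients, see [coef_sum_toS]. *)
Definition coef_sum_to {F : numFieldType} (y : F) m k : F :=
  (1 - k%:R / (m%:R * y)) * (-1) ^+ k * 'C(m, k)%:R * poch_ratio y m k.

(** The factorials cancel. The factor [(y + k) / y] comes from starting the upper product at [y + 1]
    instead of [y]; it will cancel against [y / (y + k)] in the summand. *)
Lemma gbin_poch_ratio (F : numFieldType) (y : F) m k :
    y != 0 -> y + k%:R != 0 ->
  gbin (y + k%:R) k / gbin (y - m.+1%:R + k%:R) k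
    = poch_ratio y m k * ((y + k%:R) / y).
Proof.
move=> y0 yk; rewrite !gbinE invf_div [LHS]mulrA.
rewrite divfK ?pnatr_eq0 -?lt0n ?fact_gt0 //.
rewrite /poch_ratio prodf_div mulrAC.
have -> : \prod_(j < k) (y + j.+1%:R) = (\prod_(i < k) (y + i%:R)) * ((y + k%:R) / y).
  rewrite mulrA; apply: (canRL (mulfK y0)).
  by rewrite -(big_ord_recr _ (fun i : 'I_k.+1 => y + i%:R)) big_ord_recl addr0 mulrC.
by congr (_ / _); apply: eq_bigr => i _; rewrite -addrA -[m.+1]addn1 natrD; ring.
Qed.

Lemma poch_ratioS (F : numFieldType) (y : F) m k :
  poch_ratio y m k.+1 = poch_ratio y m k * ((y + k%:R) / (y - m%:R + k%:R)).
Proof. by rewrite /poch_ratio big_ord_recr. Qed.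

(** All three terms are rational multiples of ['C(m, k) * poch_ratio y m k], which leaves a rational
    identity to check. *)
Lemma coef_sum_toS (F : numFieldType) (y : F) m k : (0 < m)%N -> (k <= m)%N ->
    y != 0 -> y + k%:R != 0 -> y - m%:R + k%:R != 0 ->
  (-1) ^+ k.+1 * 'C(m.+1, k.+1)%:R * poch_ratio y m k.+1 * ((y - 1) / (y + k%:R))
    = coef_sum_to y m k.+1 - coef_sum_to y m k.
Proof.
move=> m0 lekm y0 yk ymk; rewrite /coef_sum_to poch_ratioS.
have k1 : k.+1%:R != 0 :> F by rewrite pnatr_eq0.
have mF : m%:R != 0 :> F by rewrite pnatr_eq0 -lt0n.
have -> : 'C(m, k.+1)%:R = (m%:R - k%:R) * 'C(m, k)%:R / k.+1%:R :> F.
  by apply: (canRL (mulfK k1)); rewrite [LHS]mulrC -[LHS]natrM mul_bin_left natrM natrB.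
have -> : 'C(m.+1, k.+1)%:R = m.+1%:R * 'C(m, k)%:R / k.+1%:R :> F.
  by apply: (canRL (mulfK k1)); rewrite [LHS]mulrC -[LHS]natrM -mul_bin_diag natrM.
rewrite exprS; move: k1; rewrite -[k.+1]addn1 -[m.+1]addn1 !natrD => k1.
by field; rewrite k1 mF y0 yk ymk.
Qed.

(** * Residues and the third Taylor coefficient *)

Lemma prod_natB_neq (F : numFieldType) m j : (j <= m)%N ->
  \prod_(i < m.+1 | i != j :> nat) (i%:R - j%:R) = (-1) ^+ j * (j`! * (m - j)`!)%:R :> F.
Proof.
elim: m => [|m IH] lejm.
  move: lejm; rewrite leqn0 => /eqP ->.
  by rewrite big_mkcond big_ord1 /= mul1r.
move: lejm; rewrite leq_eqVlt => /predU1P [->|lejm].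
  (* Here [j] is the last index and the product is [(-j) ... (-1)]; an inner induction peels off its
     first factor. *)
  rewrite big_mkcond big_ord_recr /= eqxx mulr1 subnn muln1.
  elim: (m.+1) => [|k IHk]; first by rewrite big_ord0 mul1r.
  rewrite big_ord_recl /= factS natrM exprS sub0r.
  transitivity (- k.+1%:R * \prod_(i < k) (if i != k :> nat then i%:R - k%:R else 1 : F)).
    congr (_ * _); apply: eq_bigr => i _; rewrite /bump /= add1n eqSS.
    by case: eqP => // _; rewrite -!natr1; ring.
  by rewrite IHk; ring.
rewrite big_mkcond big_ord_recr /= -big_mkcond IH //= gtn_eqF //.
by rewrite subSn // factS !natrM -!natr1 natrB //=; ring.
Qed.

(** Raising [j] by one slides a window of [m] consecutive factors: it gains [y + j] and loses
    [y - m + j], which is the new factor of [poch_ratio]. *)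
Lemma prod_shift_poch_ratio (F : numFieldType) (y : F) m j :
    (forall i : nat, (i < j)%N -> y - m%:R + i%:R != 0) ->
  y * \prod_(i < m) (y + j%:R - i.+1%:R)
    = poch_ratio y m j * \prod_(i < m.+1) (y - i%:R).
Proof.
elim: j => [|j IH] hy.
  by rewrite /poch_ratio big_ord0 mul1r big_ord_recl /= addr0 subr0.
rewrite poch_ratioS mulrAC -IH => [|i ltij]; last exact/hy/ltnW.
rewrite -mulrA; congr (y * _); rewrite [RHS]mulrA.
apply: (canRL (mulfK (hy j (ltnSn j)))).
have -> : y - m%:R + j%:R = y + j.+1%:R - m.+1%:R by rewrite -!natr1; ring.
rewrite -(big_ord_recr _ (fun i : 'I_m.+1 => y + j.+1%:R - i.+1%:R)) big_ord_recl /= mulrC.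
congr (_ * _); last by rewrite -!natr1; ring.
by apply: eq_bigr => i _; rewrite /bump /= add1n -!natr1; ring.
Qed.

(** The ratio, independent of [j], between [S_j] and the residue of a quotient of monic
    polynomials. *)
Definition pf_scale {F : numFieldType} (y : F) m : F :=
  (-1) ^+ m * m`!%:R / (m%:R * \prod_(i < m.+1) (y - i%:R)).

(* [coef_sum_to y m j / pf_scale y m] is the residue at [x = - (j + 1)] of
   [(1 + x - y + n y) prod_(2 <= i <= n) (x - y + i) / prod_(1 <= i <= n) (x + i)],
   where [n = m + 1]. *)
Lemma residue_coef_sum_to (F : numFieldType) (y : F) m j :
    (0 < m)%N -> (j <= m)%N ->
    (forall i : nat, (i <= m)%N -> y - i%:R != 0) ->
    (forall i : nat, (i <= m)%N -> y - m%:R + i%:R != 0) ->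
  (m%:R * y - j%:R) * \prod_(i < m) (i.+1%:R - j%:R - y)
    = coef_sum_to y m j / pf_scale y m
      * \prod_(i < m.+1 | i != j :> nat) (i%:R - j%:R).
Proof.
move=> m0 lejm hyB hym; rewrite prod_natB_neq //.
have mF : m%:R != 0 :> F by rewrite pnatr_eq0 -lt0n.
have y0 : y != 0 by have := hyB 0%N isT; rewrite subr0.
have -> : \prod_(i < m) (i.+1%:R - j%:R - y)
    = (-1) ^+ m * \prod_(i < m) (y + j%:R - i.+1%:R).
  rewrite -[m in _ ^+ m]card_ord -prodrN.
  by apply: eq_bigr => i _; ring.
have hQ := prod_shift_poch_ratio F y m j (fun i ltij =>
  hym i (ltnW (leq_trans ltij lejm))).
have P0 : \prod_(i < m.+1) (y - i%:R) != 0.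
  by apply/prodf_neq0 => i _; apply: hyB; rewrite -ltnS.
rewrite /pf_scale /coef_sum_to -(bin_fact lejm) natrM.
have B0 : 'C(m, j)%:R != 0 :> F by rewrite pnatr_eq0 -lt0n bin_gt0.
have f0 : (j`! * (m - j)`!)%:R != 0 :> F by rewrite pnatr_eq0 -lt0n muln_gt0 !fact_gt0.
move: hQ P0 B0 f0; move: (_ * _)%:R ('C(_, _)%:R) => f B.
move: (poch_ratio y m j) (\prod_(i < m.+1) _) (\prod_(i < m) _) => q P Q hQ P0 B0 f0.
have -> : q = y * Q / P by apply: (canRL (mulfK P0)).
rewrite -(signr_odd _ m) -(signr_odd _ j).
by case: (odd m) (odd j) => -[] /=; rewrite ?expr0 ?expr1; field;
  rewrite ?mF ?y0 ?P0 ?B0 ?f0.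
Qed.

(** Divided by the product of the [t + x + i + 1], the last hypothesis equates [(1 + a / (t + 1 + x
    - y)) prod (t + x - y + j + 1) / (t + x + j + 1)] with [1 + sum r_j / (t + x + j + 1)]. The
    conclusion compares [t^3] coefficients; those of [exp_jet] are [6], [-6 dharm 1], [3 Fn] and
    [- En]. *)
Lemma third_taylor_coef (F : numFieldType) (x y a : F) m (r : nat -> F) :
    (forall j : nat, (j < m.+1)%N -> x + j.+1%:R != 0) ->
    (forall j : nat, (j < m.+1)%N -> x - y + j.+1%:R != 0) ->
    ('X + (1 + x - y + a)%:P) * \prod_(i < m) ('X + (x - y + i.+2%:R)%:P)
      = \prod_(i < m.+1) ('X + (x + i.+1%:R)%:P)
        + \sum_(j < m.+1) (r j)%:P
            * \prod_(i < m.+1 | i != j) ('X + (x + i.+1%:R)%:P) ->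
  let w := (1 + x - y)^-1 in
  (\prod_(j < m.+1) (x - y + j.+1%:R))
    * ((1 + a * w) * En m.+1 x y + 3 * a * w ^+ 2 * Fn m.+1 x y
       + 6 * a * w ^+ 3 * dharm 1 m.+1 x y + 6 * a * w ^+ 4)
  = 6 * (\prod_(j < m.+1) (x + j.+1%:R))
      * \sum_(j < m.+1) r j * (x + j.+1%:R)^-1 ^+ 4.
Proof.
move=> hx hxy; set M := \prod_(i < m.+1) ('X + _) => hpf w.
have [e] := quotient_jet F x (x - y) m.+1 hx hxy.
rewrite -!/(dharm _ _ _ _) -/M.
set J := exp_jet _ _ _; set M0 := \prod_(j < m.+1) (x + _).
set N0 := \prod_(j < m.+1) (x - y + _).
have z0 : 1 + x - y != 0 by have := hxy 0%N isT; rewrite addrC addrA.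
rewrite big_ord_recl /= [x - y + 1]addrC addrA => hJ.
(* The difference of the two jets, both scaled by [6 * M0]. Multiplying by [M * ('X + (1 + x - y))]
   turns every [inv_jet] into a polynomial identity modulo ['X^4]. *)
pose D := N0%:P * (1 + a%:P * inv_jet (1 + x - y)) * J
  - 6%:P * M0%:P * (1 + \sum_(j < m.+1) (r j)%:P * inv_jet (x + j.+1%:R)).
have XM : exists e' : {poly F}, M * (1 + \sum_(j < m.+1) (r j)%:P * inv_jet (x + j.+1%:R))
    = M + \sum_(j < m.+1) (r j)%:P
            * \prod_(i < m.+1 | i != j) ('X + (x + i.+1%:R)%:P) + 'X^4 * e'.
  exists (- \sum_(j < m.+1) (r j * (x + j.+1%:R)^-1 ^+ 4)%:P *
         \prod_(i < m.+1 | i != j) ('X + (x + i.+1%:R)%:P)).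
  rewrite mulrDr mulr1 -addrA mulrN !mulr_sumr -sumrB; congr (_ + _).
  apply: eq_bigr => j _; rewrite mulrCA {1}/M (bigD1 j) //= mulrAC.
  by rewrite inv_jetP ?hx // polyCM; ring.
have D3 : D`_3 = 0.
  apply: (@coef_mulXn_eq0 _ D (M * ('X + (1 + x - y)%:P)) 4) => //.
    rewrite -horner_coef0 hornerM horner_prod !hornerE mulf_neq0 //.
    by apply/prodf_neq0 => i _; rewrite !hornerE hx.
  have [e' he'] := XM; have hW := inv_jetP _ _ z0.
  apply/dvdpP.
  set W := inv_jet _ in hW; set Z := (1 + x - y)%:P in hW hJ *.
  move: hJ; set N := \prod_(i < m) _ => hJ.
  have hpf' : ('X + Z + a%:P) * N = M + \sum_(j < m.+1) (r j)%:P
            * \prod_(i < m.+1 | i != j) ('X + (x + i.+1%:R)%:P).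
    by rewrite -hpf polyCD addrA; congr (_ * _); apply: eq_bigr => i _.
  (* The three terms collect the errors of the product expansion, of the jet of
     [1 / (t + 1 + x - y)], and of the jets in the sum. *)
  exists (- e * ('X + Z + a%:P)
     - N0%:P * J * M * a%:P * ((1 + x - y)^-1 ^+ 4)%:P - 6%:P * M0%:P * ('X + Z) * e').
  transitivity (N0%:P * J * M * ('X + Z + a%:P * (('X + Z) * W))
     - 6%:P * M0%:P * ('X + Z) * (M * (1 + \sum_(j < m.+1) (r j)%:P * inv_jet (x + j.+1%:R)))).
    by rewrite /D -/W; ring.
  rewrite he' -hpf' hW.
  have -> : N0%:P * J * M = 6%:P * M0%:P * (('X + Z) * N) - 'X^4 * e.
    by rewrite hJ; ring.
  ring.
move: D3; rewrite /D coefB -!mulrA !coefCM coefD coef_sum coefC add0r => /eqP.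
rewrite subr_eq0 => /eqP hD.
have -> : \sum_(j < m.+1) r j * (x + j.+1%:R)^-1 ^+ 4
    = - \sum_(j < m.+1) ((r j)%:P * inv_jet (x + j.+1%:R))`_3.
  by rewrite -sumrN; apply: eq_bigr => j _; rewrite coefCM coef_jet /= mulrN opprK.
rewrite !mulrN -hD coefM !big_ord_recl big_ord0 /= /J /exp_jet.
rewrite !(coefD, coefC, coefCM, coefX, coefXn) /= /En /Fn -/w; ring.
Qed.

(** * The summation formula, with [n = m + 1] *)

Theorem theorem20 (R : realType) (n : nat) (x y : R[i])
    (hn : (2 <= n)%N)
    (hx : forall k : nat, (1 <= k <= n)%N -> x <> - k%:R)
    (hxy : forall k : nat, (1 <= k <= n)%N -> x - y <> - k%:R)
    (hy : forall j : int, - n%:Z <= j <= n%:Z - 1 -> y <> j%:~R) :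
  \sum_(0 <= k < n.+1)
     (-1) ^+ k * ('C(n, k))%:R
     * (gbin (y + k%:R) k / gbin (y - n%:R + k%:R) k)
     * ((y - 1) * y / ((y + k%:R - 1) * (y + k%:R)))
     * gharm 4 k x
  = (-1) ^+ n / (6 * n%:R * (n%:R - 1) * (1 + x - y))
    * (gbin (x - y + n%:R) n / (gbin (x + n%:R) n * gbin y n))
    * ((1 + x - y + n%:R * y) * En n x y
       + 3 * n%:R * y / (1 + x - y) * Fn n x y
       + Gn n x y).
Proof.
have hx' (j : nat) : (j < n)%N -> x + j.+1%:R != 0.
  by move=> ltjn; rewrite addr_eq0; apply/eqP/hx.
have hxy' (j : nat) : (j < n)%N -> x - y + j.+1%:R != 0.
  by move=> ltjn; rewrite addr_eq0; apply/eqP/hxy.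
have hyD (j : nat) : (j <= n)%N -> y + j%:R != 0.
  move=> lejn; rewrite addr_eq0; apply/eqP; rewrite pmulrn -rmorphN /=.
  by apply: hy; lia.
have hyB (j : nat) : (j < n)%N -> y - j%:R != 0.
  move=> ltjn; rewrite subr_eq0; apply/eqP; rewrite pmulrn.
  by apply: hy; lia.
case: n hn {hx hxy hy} hx' hxy' hyD hyB => // m hm hx hxy hyD hyB.
have m0 : (0 < m)%N by [].
have y0 : y != 0 by have := hyB 0%N isT; rewrite subr0.
have hym (i : nat) : (i <= m)%N -> y - m%:R + i%:R != 0.
  move=> leim; have := hyB (m - i)%N; rewrite natrB // opprB addrA addrAC; apply.
  by rewrite ltnS leq_subr.
have mF : m%:R != 0 :> R[i] by rewrite pnatr_eq0 -lt0n.
(* At [k = 0] this is [y <> 1], which is available because [n >= 2]. *)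
have hyB1 (k : nat) : (k <= m.+1)%N -> y + k%:R - 1 != 0.
  case: k => [_|k ltkm]; first by rewrite addr0 (hyB 1%N).
  by rewrite -natr1 addrA addrK hyD // ltnW.
rewrite (eq_big_nat _ _ (F2 := fun k => (-1) ^+ k * 'C(m.+1, k)%:R
    * poch_ratio y m k * ((y - 1) / (y + k%:R - 1)) * gharm 4 k x)); last first.
  move=> k /andP [_ lekm]; rewrite gbin_poch_ratio ?hyD //; congr (_ * _).
  by field; rewrite y0 hyD // hyB1.
rewrite (sum_gharm _ (fun k => (-1) ^+ k * 'C(m.+1, k)%:R
    * poch_ratio y m k * ((y - 1) / (y + k%:R - 1))) (coef_sum_to y m)).
(* The boundary term vanishes, since ['C(m, m.+1) = 0]. *)
- rewrite {1}/coef_sum_to bin_small // mulr0 !mul0r sub0r.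
  have z0 : 1 + x - y != 0 by have := hxy 0%N isT; rewrite addrC addrA.
  have M0 : \prod_(j < m.+1) (x + j.+1%:R) != 0.
    by apply/prodf_neq0 => j _; apply: hx.
  have P0 : \prod_(i < m.+1) (y - i%:R) != 0.
    by apply/prodf_neq0 => i _; apply: hyB.
  have f0 : m`!%:R != 0 :> R[i] by rewrite pnatr_eq0 -lt0n fact_gt0.
  have C0 : pf_scale y m != 0.
    by rewrite /pf_scale !mulf_neq0 ?signr_eq0 ?invr_eq0 // mulf_neq0.
  pose r j := coef_sum_to y m j / pf_scale y m.
  (* Multiplication by [1 + n y / (t + 1 + x - y)] replaces the first factor [t + 1 + x - y] by
     [t + 1 + x - y + n y]. *)
  pose v i := if i is 0 then 1 + x - y + m.+1%:R * y else x - y + i.+1%:R.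
  have hpf : \prod_(i < m.+1) ('X + (v i)%:P)
      = \prod_(i < m.+1) ('X + (x + i.+1%:R)%:P) + \sum_(j < m.+1) (r j)%:P
          * \prod_(i < m.+1 | i != j) ('X + (x + i.+1%:R)%:P).
    apply: (lagrange_prod _ (fun i => x + i.+1%:R)).
      by move=> i j _ _ /addrI /eqP; rewrite eqr_nat => /eqP [].
    move=> j; rewrite big_ord_recl.
    (* The differences [v i - (x + j + 1)] are free of [x], hence so are the residues. *)
    transitivity ((m%:R * y - j%:R) * \prod_(i < m) (i.+1%:R - j%:R - y)).
      congr (_ * _); first by rewrite /v /= -!natr1; ring.
      by apply: eq_bigr => i _; rewrite /v /= /bump /= add1n -!natr1; ring.
    rewrite residue_coef_sum_to //; [congr (_ * _) | by rewrite -ltnS].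
    by apply: eq_bigr => i _; rewrite -!natr1; ring.
  rewrite big_ord_recl /= in hpf.
  have := third_taylor_coef _ x y (m.+1%:R * y) m r hx hxy hpf.
  have -> : \sum_(j < m.+1) r j * (x + j.+1%:R)^-1 ^+ 4
      = (\sum_(j < m.+1) coef_sum_to y m j * (x + j.+1%:R)^-1 ^+ 4) / pf_scale y m.
    by rewrite mulr_suml; apply: eq_bigr => j _; rewrite mulrAC.
  set S := \sum_(j < _) _ => /= H.
  have -> : S = pf_scale y m * (6 * \prod_(j < m.+1) (x + j.+1%:R))^-1
      * (6 * \prod_(j < m.+1) (x + j.+1%:R) * (S / pf_scale y m)).
    by field; rewrite C0 M0.
  rewrite -{}H !gbinE [gbin y _]/gbin /Gn /pf_scale factS natrM.
  have n0 : m.+1%:R != 0 :> R[i] by rewrite pnatr_eq0.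
  move: n0; rewrite [(-1) ^+ _.+1]exprS -[m.+1%:R]natr1 => n0.
  move: n0 mF M0 P0 f0 z0; move: (En _ _ _) (Fn _ _ _) (dharm _ _ _ _) => E Fm d.
  move: (\prod_(i < _) _) (\prod_(i < _) _) (\prod_(i < _) _) => A B C.
  move: (m%:R) (m`!%:R) ((-1) ^+ m) => mr f s n0 mF M0 P0 f0 z0.
  by rewrite addrK; field; rewrite z0 f0 n0 P0 M0 mF.
- by rewrite /coef_sum_to /poch_ratio /= !big_ord0 !bin0 !mul0r subr0 expr0 !mul1r
    addr0 divff // (hyB 1%N).
move=> k; rewrite ltnS => lekm.
by rewrite -coef_sum_toS ?hyD ?hym // -?natr1 ?addrA ?addrK // leqW.
Qed.
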